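(* Let $F\subseteq\mathbb{R}^d$ be a non-empty compact set. Let $\Phi=\{\varphi_i\}_{i\in\Lambda}$ be an IFS of homotheties and let $T\in\mathcal{T}'_\Lambda$ be a tree without leaves such that $F=\Gamma_\Phi(T)$. Then every F-miniset of a member of $\overline{\mathcal{S}_\Phi^T}$ is an F-microset of $F$.
   Context: $Q=[0,1]^d$. A homothety of $\mathbb{R}^d$ is a map $x\mapsto rx+\alpha$ with $r>0$, $\alpha\in\mathbb{R}^d$; it is contracting if $r<1$ and expanding if $r\ge1$. For a compact $F\subseteq\mathbb{R}^d$, an F-miniset of $F$ is a non-empty compact subset of a set of the form $Q\cap\varphi(F)$ with $\varphi$ an expanding homothety; an F-microset of $F$ is any limit of F-minisets of $F$ in the Hausdorff metric. An IFS of homotheties is a finite non-empty collection $\Phi=\{\varphi_i\}_{i\in\Lambda}$ of contracting homotheties of $\mathbb{R}^d$. The coding map is $\gamma_\Phi(i)=\lim_{n}\varphi_{i_1}\circ\dots\circ\varphi_{i_n}(0)$ for $i\in\Lambda^{\mathbb{N}}$. A tree with alphabet $\Lambda$ is a set $T\subseteq\Lambda^*=\bigcup_{n\ge0}\Lambda^n$ containing the empty word and closed under taking prefixes; $\partial T=\{i\in\Lambda^{\mathbb{N}}: i_1\dots i_n\in T\ \forall n\}$. $\mathcal{T}'_\Lambda$ is the set of trees with alphabet $\Lambda$ without leaves (every $v\in T$ has some $j\in\Lambda$ with $vj\in T$). For a tree $T$ with non-empty boundary, $\Gamma_\Phi(T)=\gamma_\Phi(\partial T)$. For $v\in T$, $T^v=\{w\in\Lambda^*: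 vw\in T\}$; $\mathcal{S}_\Phi^T=\{\Gamma_\Phi(T^v): v\in T\}$, and $\overline{\mathcal{S}_\Phi^T}$ is its closure in the Hausdorff metric. *)

(* Defs.v *)
From HB Require Import structures.
From mathcomp Require Import all_boot all_order all_algebra.
From mathcomp Require Import all_classical all_reals all_analysis.

Set Implicit Arguments.
Unset Strict Implicit.
Unset Printing Implicit Defensive.

Import Order.TTheory GRing.Theory Num.Theory.
Import numFieldNormedType.Exports.

Local Open Scope classical_set_scope.
Local Open Scope ring_scope.

Section HausdorffMetric.
Context {R : realType} {d : nat}.
Implicit Types (A B : set 'rV[R]_d) (S : set (set 'rV[R]_d)).

(* The library norm on 'rV[R]_d is the sup norm, which induces the same topology
   as this distance (hence the same compact sets). *)
Definition euclidean_dist (x y : 'rV[R]_d) : R :=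
  Num.sqrt (\sum_(j < d) (x 0 j - y 0 j) ^+ 2).

Definition thickening (e : R) A : set 'rV[R]_d :=
  [set x | exists2 a, A a & euclidean_dist x a <= e].

(* Extended-real valued, so that the infimum of an empty set of radii is +oo;
   it is finite on non-empty compact sets. *)
Definition hausdorff_dist A B : \bar R :=
  ereal_inf [set e%:E | e in
    [set e : R | [/\ 0 <= e, A `<=` thickening e B & B `<=` thickening e A]]].

Definition nonempty_compact A : Prop := A !=set0 /\ compact A.

Definition hausdorff_limit (M : nat -> set 'rV[R]_d) A : Prop :=
  nonempty_compact A /\ hausdorff_dist (M n) A @[n --> \oo] --> 0%E.

(* Closure in the space of non-empty compact sets. *)
Definition hausdorff_closure S : set (set 'rV[R]_d) :=
  [set A | nonempty_compact A /\
    forall e : R, 0 < e -> exists2 B, S B & (hausdorff_dist A B < e%:E)%E].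

End HausdorffMetric.

Record homothety (R : realType) (d : nat) := Homothety {
  ratio : R;
  shift : 'rV[R]_d;
  ratio_gt0 : 0 < ratio }.

Definition homothety_fun (R : realType) (d : nat) (phi : homothety R d)
  (x : 'rV[R]_d) : 'rV[R]_d := ratio phi *: x + shift phi.
Coercion homothety_fun : homothety >-> Funclass.

Definition contracting (R : realType) (d : nat) (phi : homothety R d) : Prop :=
  ratio phi < 1.

Definition expanding (R : realType) (d : nat) (phi : homothety R d) : Prop :=
  1 <= ratio phi.

Definition unit_cube (R : realType) (d : nat) : set 'rV[R]_d :=
  [set x | forall j, 0 <= x 0 j <= 1].

Definition Fminiset (R : realType) (d : nat) (F M : set 'rV[R]_d) : Prop :=
  nonempty_compact M /\
  exists2 phi : homothety R d,
    expanding phi & M `<=` @unit_cube R d `&` phi @` F.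

Definition Fmicroset (R : realType) (d : nat) (F A : set 'rV[R]_d) : Prop :=
  exists2 M : nat -> set 'rV[R]_d,
    forall n, Fminiset F (M n) & hausdorff_limit M A.

Record homothety_IFS (R : realType) (d : nat) (L : finType) := HomothetyIFS {
  ifs_map :> L -> homothety R d;
  ifs_nonempty : (0 < #|L|)%N;
  ifs_contracting : forall i, contracting (ifs_map i) }.

Section Coding.
Context {R : realType} {d : nat} {L : finType}.
Implicit Types (Phi : homothety_IFS R d L) (T : set (seq L)).

Definition word_map Phi (w : seq L) (x : 'rV[R]_d) : 'rV[R]_d :=
  foldr (fun j y => Phi j y) x w.

(* Infinite words are indexed from 0; mkseq i n is the prefix of i of length n. *)
Definition coding_map Phi (i : nat -> L) : 'rV[R]_d :=
  lim (word_map Phi (mkseq i n) 0 @[n --> \oo]).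

Definition is_tree T : Prop :=
  T [::] /\ forall v w, T (v ++ w) -> T v.

Definition leafless T : Prop := forall v, T v -> exists j, T (rcons v j).

Definition boundary T : set (nat -> L) := [set i | forall n, T (mkseq i n)].

Definition Gamma Phi T : set 'rV[R]_d := coding_map Phi @` boundary T.

Definition descendants T (v : seq L) : set (seq L) := [set w | T (v ++ w)].

Definition descendant_sets Phi T : set (set 'rV[R]_d) :=
  [set Gamma Phi (descendants T v) | v in T].

End Coding.

(* Main.v *)
(* If A is at distance 0 from F, then A is contained in F.  Otherwise A is a limit
   of sets Gamma(T^v) with v nonempty, and word_map v sends Gamma(T^v) into F with
   ratio at most some rho < 1.  Hence, for psi expanding, psi o (word_map v)^-1 has
   ratio at least 1/rho, which leaves room to compose it with a slight contraction
   towards the centre of the cube while staying expanding; this brings back into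
   the cube the points of psi(Gamma(T^v)) that approximate M from outside. *)
Require Import Defs.
From mathcomp Require Import all_boot all_order all_algebra.
From mathcomp Require Import all_classical all_reals all_analysis.
From mathcomp Require Import ring lra.
Import Order.TTheory GRing.Theory Num.Theory.
Import numFieldNormedType.Exports.
(* Imported again because [ratio] would otherwise denote MathComp's fractions. *)
Import Defs.
Set Implicit Arguments.
Unset Strict Implicit.
Unset Printing Implicit Defensive.
Local Open Scope classical_set_scope.
Local Open Scope ring_scope.

(** * Euclidean versus sup norm, and the Hausdorff distance *)

Section EuclideanDistance.
Context {R : realType} {d : nat}.
Implicit Types (x y : 'rV[R]_d) (A B : set 'rV[R]_d).

Lemma normr_coord_le x j : `|x 0 j| <= `|x|.
Proof.
rewrite [leRHS]mx_normrE.
exact: (@le_bigmax _ _ _ 0 (fun ij : 'I_1 * 'I_d => `|x ij.1 ij.2|) (0, j)).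
Qed.

Lemma normr_row_le x (e : R) : 0 <= e -> (forall j, `|x 0 j| <= e) -> `|x| <= e.
Proof.
move=> e0 xe; rewrite [leLHS]mx_normrE; apply/bigmax_leP; split=> // -[i j] _ /=.
by rewrite (ord1 i).
Qed.

Lemma normr_le_euclidean_dist x y : `|x - y| <= euclidean_dist x y.
Proof.
apply: normr_row_le => [|j]; first exact: sqrtr_ge0.
rewrite !mxE -sqrtr_sqr; apply: ler_wsqrtr; rewrite (bigD1 j) //= lerDl.
by apply: sumr_ge0 => k _; exact: sqr_ge0.
Qed.

(** The sharp constant is the square root of [d]; the cruder [d] avoids a root, by [d <= d ^ 2] for
    natural numbers. *)
Lemma euclidean_dist_le x y : euclidean_dist x y <= d%:R * `|x - y|.
Proof.
have h0 : 0 <= d%:R * `|x - y| by rewrite mulr_ge0.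
rewrite -[leRHS]ger0_norm // -sqrtr_sqr; apply: ler_wsqrtr.
apply: (@le_trans _ _ (\sum_(j < d) `|x - y| ^+ 2)).
  apply: ler_sum => j _; rewrite -[leLHS]real_normK ?num_real// lerXn2r ?nnegrE//.
  by have := normr_coord_le (x - y) j; rewrite !mxE.
rewrite sumr_const card_ord -[leLHS]mulr_natl exprMn ler_wpM2r ?sqr_ge0//.
by rewrite -natrX ler_nat; case: (d) => // n; rewrite expnS leq_pmulr.
Qed.

Lemma euclidean_dist_refl x : euclidean_dist x x = 0.
Proof. by rewrite /euclidean_dist big1 ?sqrtr0// => j _; rewrite subrr expr0n. Qed.

Lemma hausdorff_dist_le A B (e : R) : 0 <= e ->
  A `<=` thickening e B -> B `<=` thickening e A -> (hausdorff_dist A B <= e%:E)%E.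
Proof. by move=> e0 AB BA; apply: ereal_inf_lbound; exists e. Qed.

Lemma hausdorff_dist_ge0 A B : (0 <= hausdorff_dist A B)%E.
Proof. by apply: le_ereal_inf_tmp => _ [e [e0 _ _] <-]; rewrite lee_fin. Qed.

Lemma hausdorff_dist_lt_thickening A B (e : R) :
  (hausdorff_dist A B < e%:E)%E -> A `<=` thickening e B.
Proof.
move=> /ereal_inf_lt[_ [r [r0 AB _] <-]]; rewrite lte_fin => re a /AB[b Bb ab].
by exists b => //; rewrite (le_trans ab)// ltW.
Qed.

Lemma sub_of_hausdorff_dist_lt A B : compact B ->
  (forall e : R, 0 < e -> (hausdorff_dist A B < e%:E)%E) -> A `<=` B.
Proof.
move=> cB AB a Aa.
have /compact_closed : hausdorff_space 'rV[R]_d by exact: norm_hausdorff.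
move=> /(_ _ cB); apply => U /nbhs_normP[e /= e0 eU].
have e20 : 0 < e / 2 by rewrite divr_gt0.
have [b Bb ab] := hausdorff_dist_lt_thickening (AB _ e20) Aa.
exists b; split => //; apply: eU; rewrite /ball_ /=.
apply: le_lt_trans (normr_le_euclidean_dist _ _) _; lra.
Qed.

End EuclideanDistance.

(** * Homotheties, the cube and the construction of minisets *)

Section Microsets.
Context {R : realType} {d : nat}.
Implicit Types (x y : 'rV[R]_d) (F M : set 'rV[R]_d).

(** Reduces the limit to a single scale: choose minisets at the scales [1 / (n + 1)] and squeeze. *)
Lemma Fmicroset_approx F M : nonempty_compact M ->
  (forall e : R, 0 < e -> exists M', [/\ Fminiset F M',
    M' `<=` thickening e M & M `<=` thickening e M']) ->
  Fmicroset F M.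
Proof.
move=> cM approx.
have /choice[N NP] : forall n : nat, exists M', [/\ Fminiset F M',
    M' `<=` thickening (n.+1%:R^-1 : R) M & M `<=` thickening (n.+1%:R^-1) M'].
  by move=> n; apply: approx; rewrite invr_gt0.
exists N => [n|]; first by case: (NP n).
split=> //; apply: (@squeeze_cvge _ _ _ _ (cst 0%E) _ (fun n => (n.+1%:R^-1)%:E)).
- near=> n; case: (NP n) => _ NM MN; rewrite hausdorff_dist_ge0/=.
  by apply: hausdorff_dist_le; rewrite ?invr_ge0.
- exact: cvg_cst.
- apply: cvg_EFin; first exact: nearW.
  exact: cvg_harmonic.
Unshelve. all: by end_near. Qed.

Lemma homothety_continuous (phi : homothety R d) : continuous phi.
Proof.
move=> x; exact: (@cvgD _ 'rV[R]_d _ _ _ (fun y : 'rV[R]_d => ratio phi *: y)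
  (fun=> shift phi) _ _ (@scaler_continuous _ 'rV[R]_d _ x) (cvg_cst _)).
Qed.

Lemma closed_unit_cube : closed (@unit_cube R d).
Proof.
have -> : @unit_cube R d =
    \bigcap_(j : 'I_d) ((fun x : 'rV[R]_d => x 0 j) @^-1` `[0, 1]).
  apply/seteqP; split => [x xQ j _ /=|x xQ j]; first by rewrite in_itv/=; exact: xQ.
  by have := xQ j I; rewrite /= in_itv.
apply: closed_bigI => j _; apply: preimage_closed; last exact: interval_closed.
by move=> x _; exact: coord_continuous.
Qed.

Definition comp_homothety (phi psi : homothety R d) : homothety R d :=
  @Homothety R d (ratio phi * ratio psi) (phi (shift psi))
    (mulr_gt0 (ratio_gt0 phi) (ratio_gt0 psi)).

Lemma comp_homothetyE (phi psi : homothety R d) x :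
  comp_homothety phi psi x = phi (psi x).
Proof. by rewrite /homothety_fun /= /homothety_fun scalerDr scalerA addrA. Qed.

Lemma inv_ratio_gt0 (phi : homothety R d) : 0 < (ratio phi)^-1.
Proof. by rewrite invr_gt0 ratio_gt0. Qed.

Definition inv_homothety (phi : homothety R d) : homothety R d :=
  @Homothety R d (ratio phi)^-1 (- ((ratio phi)^-1 *: shift phi)) (inv_ratio_gt0 phi).

Lemma homothetyK (phi : homothety R d) : cancel phi (inv_homothety phi).
Proof.
move=> x; rewrite /homothety_fun /= scalerDr scalerA mulVf ?scale1r ?addrK//.
by rewrite gt_eqF ?ratio_gt0.
Qed.

Lemma homothetyB (phi : homothety R d) x y : phi x - phi y = ratio phi *: (x - y).
Proof. by rewrite /homothety_fun opprD addrACA subrr addr0 scalerBr. Qed.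

Lemma norm_homothetyB (phi : homothety R d) x y :
  `|phi x - phi y| = ratio phi * `|x - y|.
Proof. by rewrite homothetyB normrZ gtr0_norm ?ratio_gt0. Qed.

(* The shift makes the centre of the cube the fixed point. *)
Definition cube_shrink (s : R) (s0 : 0 < s) : homothety R d :=
  @Homothety R d s (const_mx ((1 - s) / 2)) s0.

(** With [u = 1 - s], [x] lies in the concentric cube of half-width [(1 + u) / 2], which shrinks to
    half-width [(1 - u) * (1 + u) / 2 <= 1 / 2]. The shrinking moves each coordinate of [x] by at
    most [u * (1 + u) / 2 <= u], on top of the [u / 2] between [m] and [x]. *)
Lemma cube_shrink_near (s : R) (s0 : 0 < s) m x : s < 1 ->
  unit_cube m -> `|m - x| <= (1 - s) / 2 ->
  unit_cube (cube_shrink s0 x) /\ `|m - cube_shrink s0 x| <= 2 * (1 - s).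
Proof.
move=> s1 mQ mx.
have xj j : - ((1 - s) / 2) <= m 0 j - x 0 j <= (1 - s) / 2.
  rewrite -ler_norml; apply: le_trans mx.
  by have := normr_coord_le (m - x) j; rewrite !mxE.
split=> [j|].
  have /andP[? ?] := mQ j; have /andP[? ?] := xj j.
  rewrite /homothety_fun !mxE /=; apply/andP; split; nra.
apply: normr_row_le => [|j]; first lra.
have /andP[? ?] := mQ j; have /andP[? ?] := xj j.
by rewrite /homothety_fun !mxE /= ler_norml; apply/andP; split; nra.
Qed.

(* The points of [unit_cube `&` g @` F] close to [M] form a compact set, as the
   projection of a closed subset of [M `*` F]. *)
Lemma Fminiset_near F M (g : homothety R d) (e : R) :
  compact F -> nonempty_compact M -> expanding g ->
  (forall m, M m -> exists2 x, F x & unit_cube (g x) /\ `|m - g x| <= e) ->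
  exists M', [/\ Fminiset F M',
    M' `<=` thickening (d%:R * e) M & M `<=` thickening (d%:R * e) M'].
Proof.
move=> cF [[m0 Mm0] cM] g1 near_g.
pose P := (M `*` F) `&` [set p | unit_cube (g p.2) /\ `|p.1 - g p.2| <= e].
have cg : continuous (fun p : 'rV[R]_d * 'rV[R]_d => g p.2).
  by move=> p; apply: continuous_comp; [exact: cvg_snd|exact: homothety_continuous].
have cP : compact P.
  apply: (@subclosed_compact _ _ (M `*` F)); [|exact: compact_setX|exact: subIsetl].
  apply: closedI; first by apply: compact_closed; [exact: norm_hausdorff|exact: compact_setX].
  apply: closedI.
    by apply: (@preimage_closed _ _ _ (@unit_cube R d)) => [p _|];
      [exact: cg|exact: closed_unit_cube].
  apply: (@preimage_closed _ _ (fun p : 'rV[R]_d * 'rV[R]_d => `|p.1 - g p.2|)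
    [set r | r <= e]) => [p _|]; last exact: closed_le.
  by apply: cvg_norm; apply: cvgB; [exact: cvg_fst|exact: cg].
exists ((fun p : 'rV[R]_d * 'rV[R]_d => g p.2) @` P); split.
- split.
    split.
      by have [x Fx Qx] := near_g _ Mm0; exists (g x), (m0, x).
    by apply: continuous_compact => //; exact: continuous_subspaceT.
  exists g => // _ [[m x] [[/= _ Fx] [Qx _]] <-]; split=> //.
  by exists x.
- move=> _ [[m x] [[/= Mm Fx] [_ mx]] <-]; exists m => //.
  by apply: le_trans (euclidean_dist_le _ _) _; rewrite distrC ler_wpM2l.
- move=> m Mm; have [x Fx [Qx mx]] := near_g _ Mm; exists (g x).
    by exists (m, x).
  by apply: le_trans (euclidean_dist_le _ _) _; rewrite ler_wpM2l.
Qed.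

End Microsets.

(** * Word maps, the coding map and concatenation *)

Section CodingMap.
Context {R : realType} {d : nat} {L : finType}.
Variable Phi : homothety_IFS R d L.
Implicit Types (v w : seq L) (i : nat -> L) (T : set (seq L)).

Lemma ifs_ratio_bound : exists rho : R,
  [/\ 0 < rho, rho < 1 & forall j, ratio (Phi j) <= rho].
Proof.
have /card_gt0P[j0 _] := ifs_nonempty Phi.
case: (@Order.TotalTheory.arg_maxP _ _ _ j0 xpredT (fun j => ratio (Phi j)) isT) => j _ jmax.
by exists (ratio (Phi j)); split; [exact: ratio_gt0|exact: ifs_contracting|move=> k; exact: jmax].
Qed.

Lemma word_map_cat v w x : word_map Phi (v ++ w) x = word_map Phi v (word_map Phi w x).
Proof. by rewrite /word_map foldr_cat. Qed.

Lemma word_map_homothety w : exists phi : homothety R d,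
  word_map Phi w = phi /\ ratio phi = \prod_(j <- w) ratio (Phi j).
Proof.
elim: w => [|j w [phi [IHw IHr]]].
  exists (@Homothety R d 1 0 ltr01); split; last by rewrite big_nil.
  by apply/funext => x; rewrite /homothety_fun /= scale1r addr0.
exists (comp_homothety (Phi j) phi); split; last by rewrite big_cons -IHr.
by apply/funext => x; rewrite comp_homothetyE -IHw.
Qed.

Lemma prod_ratio_le (rho : R) w : (forall j, ratio (Phi j) <= rho) ->
  0 <= \prod_(j <- w) ratio (Phi j) <= rho ^+ size w.
Proof.
move=> hrho; elim: w => [|j w /andP[IH0 IH]]; first by rewrite big_nil ler01 lexx.
have j0 := ltW (ratio_gt0 (Phi j)).
by rewrite big_cons exprS mulr_ge0//= ler_pM.
Qed.

(** The bound [S / (1 - rho)] solves [K = rho * K + S], so every [Phi j] maps the ball of radius [K]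
    about 0 into itself. *)
Lemma word_map0_bounded : exists K : R, forall w, `|word_map Phi w 0| <= K.
Proof.
have [rho [rho0 rho1 hrho]] := ifs_ratio_bound.
pose S : R := \sum_j `|shift (Phi j)|.
have S0 : 0 <= S by apply: sumr_ge0.
exists (S / (1 - rho)); have K0 : 0 <= S / (1 - rho) by rewrite divr_ge0// subr_ge0 ltW.
elim=> [|j w IH]; first by rewrite /= normr0.
apply: le_trans (ler_normD _ _) _.
have -> : S / (1 - rho) = rho * (S / (1 - rho)) + S by field; lra.
rewrite lerD// ?normrZ ?gtr0_norm ?ratio_gt0//.
  by rewrite ler_pM// ltW ?ratio_gt0.
by rewrite /S (bigD1 j)//= lerDl sumr_ge0.
Qed.

Lemma mkseqD i m n : mkseq i (m + n) = mkseq i m ++ mkseq (fun k => i (m + k)%N) n.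
Proof.
rewrite /mkseq iotaD map_cat; congr (_ ++ _).
by rewrite add0n -[X in iota X _]addn0 iotaDl -map_comp.
Qed.

(** Cauchy: beyond [N] letters, the terms are images of points of norm at most [K] under the word
    map of the prefix of length [N], so they stay within [K * rho ^+ N] of the image of 0. *)
Lemma coding_map_cvg i : cvg (word_map Phi (mkseq i n) 0 @[n --> \oo]).
Proof.
apply: cauchy_cvg; apply: cauchy_exP => e e0.
have [rho [rho0 rho1 hrho]] := ifs_ratio_bound.
have [K hK] := word_map0_bounded.
have K0 : 0 <= K by apply: le_trans (hK [::]).
have : (geometric K rho) n @[n --> \oo] --> 0 by apply: cvg_geometric; rewrite gtr0_norm.
move=> /cvgrPdist_lt/(_ _ e0)[N _ /(_ N (leqnn N))].
rewrite /= sub0r normrN ger0_norm ?mulr_ge0 ?exprn_ge0 ?(ltW rho0)// => KN.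
exists (word_map Phi (mkseq i N) 0); exists N => // n /= Nn.
rewrite -ball_normE /= -(subnKC Nn) mkseqD word_map_cat.
have [phi [-> phir]] := word_map_homothety (mkseq i N).
rewrite norm_homothetyB sub0r normrN phir.
have /andP[p0 pN] := prod_ratio_le (mkseq i N) hrho.
apply: le_lt_trans KN; rewrite mulrC ler_pM//.
by rewrite size_mkseq in pN.
Qed.

(** [L] has no distinguished letter, so [i 0] serves as the default of [nth]. *)
Definition cat_stream v i : nat -> L :=
  fun n => if (n < size v)%N then nth (i 0%N) v n else i (n - size v)%N.

Lemma mkseq_cat_stream v i n : mkseq (cat_stream v i) (size v + n) = v ++ mkseq i n.
Proof.
rewrite mkseqD; congr (_ ++ _); last first.
  by apply: eq_mkseq => k; rewrite /cat_stream ltnNge leq_addr /= addKn.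
apply: (@eq_from_nth _ (i 0%N)); rewrite size_mkseq// => k kv.
by rewrite nth_mkseq// /cat_stream kv.
Qed.

(** Dropping the first [size v] terms keeps the limit, and the continuous [word_map Phi v] commutes
    with it. *)
Lemma coding_map_cat_stream v i :
  coding_map Phi (cat_stream v i) = word_map Phi v (coding_map Phi i).
Proof.
apply: cvg_lim; first exact: norm_hausdorff.
rewrite -(cvg_shiftn (size v)).
have -> : [sequence word_map Phi (mkseq (cat_stream v i) (n + size v)) 0]_n =
    word_map Phi v \o (fun n => word_map Phi (mkseq i n) 0).
  by apply/funext => n /=; rewrite addnC mkseq_cat_stream word_map_cat.
have [phi [-> _]] := word_map_homothety v.
by apply: continuous_cvg; [exact: homothety_continuous|exact: coding_map_cvg].
Qed.

Lemma word_map_Gamma_descendants T v x : is_tree T ->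
  Gamma Phi (descendants T v) x -> Gamma Phi T (word_map Phi v x).
Proof.
move=> [_ Tpre] [i iT <-]; exists (cat_stream v i); last exact: coding_map_cat_stream.
(* Extending the prefix to length [n + size v] gives [v] followed by a prefix of [i], which is in
   [T]; prefix closure does the rest. *)
move=> n; apply: (Tpre _ (mkseq (fun k => cat_stream v i (n + k)%N) (size v))).
by rewrite -mkseqD addnC mkseq_cat_stream; exact: iT.
Qed.

End CodingMap.

(** * Approximating a miniset of a limit set by minisets of [F] *)

Lemma descendants_nil (L : finType) (T : set (seq L)) : descendants T [::] = T.
Proof. by []. Qed.

Theorem theorem5p4 (R : realType) (d : nat) (F : set 'rV[R]_d)
  (F_neq0 : F !=set0) (F_compact : compact F)
  (L : finType) (Phi : homothety_IFS R d L) (T : set (seq L))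
  (T_tree : is_tree T) (T_leafless : leafless T) (F_eq : F = Gamma Phi T)
  (A : set 'rV[R]_d) (A_closure : hausdorff_closure (descendant_sets Phi T) A)
  (M : set 'rV[R]_d) (M_miniset : Fminiset A M) :
  Fmicroset F M.
Proof.
have [cM [psi psi1 Mpsi]] := M_miniset; have [_ A_near] := A_closure.
have [AF|] := pselect (forall e : R, 0 < e -> (hausdorff_dist A F < e%:E)%E).
  have {}AF := sub_of_hausdorff_dist_lt F_compact AF.
  apply: Fmicroset_approx => // e e0; exists M; split.
  - split=> //; exists psi => // x Mx; have [Qx [a Aa ax]] := Mpsi _ Mx.
    by split=> //; exists a => //; apply: AF.
  - by move=> x Mx; exists x => //; rewrite euclidean_dist_refl ltW.
  - by move=> x Mx; exists x => //; rewrite euclidean_dist_refl ltW.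
move=> /existsNP[e1 /not_implyP[e10 AFe1]].
have [rho [rho0 rho1 hrho]] := ifs_ratio_bound Phi.
have r0 := ratio_gt0 psi.
apply: Fmicroset_approx => // e e0.
(* The first bound keeps [g] expanding, the second makes the final error [d * (2 * t)] at most [e];
   [d.+1] avoids dividing by zero when [d = 0]. *)
pose t := Num.min (1 - rho) (e / (2 * d.+1%:R)).
have t0 : 0 < t by rewrite lt_min subr_gt0 rho1 divr_gt0// mulr_gt0.
have trho : t <= 1 - rho by rewrite ge_min lexx.
have te : d%:R * (2 * t) <= e.
  apply: (@le_trans _ _ (d.+1%:R * (2 * t))).
    by rewrite ler_wpM2r ?ler_nat// mulr_ge0// ltW.
  rewrite mulrA [_ * 2]mulrC [leLHS]mulrC -ler_pdivlMr ?mulr_gt0//.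
  by rewrite /t ge_min lexx orbT.
(* The bound [e1] rules out the empty word [v]; the other one ensures that [psi] sends [e2]-close
   points to within [t / 2], as [cube_shrink_near] requires for [s = 1 - t]. *)
pose e2 := Num.min e1 (t / 2 / ratio psi).
have e20 : 0 < e2 by rewrite lt_min e10 !divr_gt0.
have [_ [v Tv <-] ABe2] := A_near _ e20.
have v0 : v != [::].
  apply/eqP => v0; apply: AFe1; rewrite v0 descendants_nil -F_eq in ABe2.
  by apply: lt_le_trans ABe2 _; rewrite lee_fin ge_min lexx.
have [phi [phiE phir]] := word_map_homothety Phi v.
have phirho : ratio phi <= rho.
  have /andP[_] := prod_ratio_le v hrho; rewrite -phir => /le_trans; apply.
  by case: (v) v0 => // j w _; rewrite exprS ler_piMr ?exprn_ile1 ?ltW.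
have s0 : 0 < 1 - t by lra.
pose g := comp_homothety (cube_shrink s0) (comp_homothety psi (inv_homothety phi)).
have g1 : expanding g.
  rewrite /expanding /= mulrA ler_pdivlMr ?ratio_gt0// mul1r.
  (* The chain is [ratio phi <= rho <= 1 - t <= (1 - t) * ratio psi]. *)
  rewrite /expanding in psi1; apply: (le_trans phirho); nra.
have [m Mm|M' [mM' M'M MM']] := Fminiset_near (e := 2 * t) F_compact cM g1.
  have [Qm [a Aa am]] := Mpsi _ Mm.
  have [b Bb ab] := hausdorff_dist_lt_thickening ABe2 Aa.
  (* This point of [F] is [phi b], so [g] sends it to the shrunken image of [psi b], and [psi b] is
     close to [m = psi a]. *)
  exists (word_map Phi v b); first by rewrite F_eq; exact: word_map_Gamma_descendants.
  rewrite phiE /g !comp_homothetyE homothetyK.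
  have mb : `|m - psi b| <= (1 - (1 - t)) / 2.
    rewrite -am norm_homothetyB mulrC -ler_pdivlMr//.
    apply: le_trans (normr_le_euclidean_dist _ _) _; apply: le_trans ab _.
    by rewrite ge_min (_ : 1 - (1 - t) = t) ?lexx ?orbT//; ring.
  have [|Qx mx] := cube_shrink_near s0 _ Qm mb; first lra.
  by split=> //; rewrite (le_trans mx)//; lra.
exists M'; split=> // x.
- by move=> /M'M[y My xy]; exists y => //; exact: le_trans xy te.
- by move=> /MM'[y My xy]; exists y => //; exact: le_trans xy te.
Qed.
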